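(* Let $N\ge 2$ be an integer and $\alpha>-2$, and let $$\gamma(N,\alpha):=2-\frac N2+\frac{\alpha}{2}+\frac{\sqrt{(\alpha+2)(\alpha+2N-2)}}{2}.$$ (a) If $N=10+4\alpha$, then the function $u(x)=\big|\log|x|\big|$ is a radially decreasing, unbounded function in $H^1(B_1)$ which is a semi-stable solution of $$-\Delta u=(N-2)\,|x|^\alpha e^{(2+\alpha)u}\quad\text{in }B_1\setminus\{0\}.$$ (b) If $N>10+4\alpha$, then for every real number $\gamma$ with $\gamma(N,\alpha)\leq\gamma<0$ the function $u(x)=|x|^\gamma-1$ is a radially decreasing, unbounded function in $H^1(B_1)$ which is a semi-stable solution of $$-\Delta u=|x|^\alpha(-\gamma)(\gamma+N-2)(1+u)^{1+\frac{2+\alpha}{-\gamma}}\quad\text{in }B_1\setminus\{0\}.$$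
   Context: $B_1$ is the open unit ball of $\mathbb{R}^N$ centered at the origin. A solution $u\in H^1(B_1)$ of $-\Delta u=|x|^\alpha f(u)$ in $B_1\setminus\{0\}$ is called semi-stable if $$\int_{B_1}\left(|\nabla\varphi|^2-|x|^\alpha f'(u)\varphi^2\right)dx\geq 0$$ for all $\varphi\in C^1(B_1)$ with compact support in $B_1\setminus\{0\}$. In (a), $f(t)=(N-2)e^{(2+\alpha)t}$; in (b), $f(t)=(-\gamma)(\gamma+N-2)(1+t)^{1+\frac{2+\alpha}{-\gamma}}$ for $t\ge 0$, which are the only values taken by $u$ on $B_1\setminus\{0\}$. *)

(* Defs.v *)
From HB Require Import structures.
From mathcomp Require Import all_boot all_order all_algebra.
From mathcomp Require Import all_classical all_reals all_analysis.

Set Implicit Arguments.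
Unset Strict Implicit.
Unset Printing Implicit Defensive.
Import Order.TTheory GRing.Theory Num.Theory.
Import numFieldNormedType.Exports.
Local Open Scope classical_set_scope.
Local Open Scope ring_scope.

(* The product sigma-algebra on R^n: the one generated by the coordinates,
   as the library does for n.-tuple. *)
Definition rV_display : measure_display.
Proof. exact: default_measure_display. Qed.

Section measurable_rV.
Context {R : realType} (n : nat).

Let coor (i : 'I_n) (x : 'rV[R]_n) : measurableTypeR R := x 0 i.

Let rV_set0 : g_sigma_preimage coor set0.
Proof. exact: sigma_algebra0. Qed.

Let rV_setC A : g_sigma_preimage coor A -> g_sigma_preimage coor (~` A).
Proof. exact: sigma_algebraC. Qed.

Let rV_bigcup (F : (set 'rV[R]_n)^nat) :
  (forall i, g_sigma_preimage coor (F i)) ->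
  g_sigma_preimage coor (\bigcup_i (F i)).
Proof. exact: sigma_algebra_bigcup. Qed.

HB.instance Definition _ := @isMeasurable.Build rV_display
  'rV[R]_n (g_sigma_preimage coor) rV_set0 rV_setC rV_bigcup.

Lemma measurable_coor (i : 'I_n) :
  measurable_fun [set: 'rV[R]_n] (coor i).
Proof.
move=> _ Y mY; rewrite setTI; apply: sub_sigma_algebra => /=.
rewrite -bigcup_seq/=; exists i => /=; first by rewrite mem_index_enum.
by exists Y => //; rewrite setTI.
Qed.

Lemma measurable_fun_rV d (T : measurableType d) (f : T -> 'rV[R]_n) :
  (forall i, measurable_fun [set: T] (coor i \o f)) ->
  measurable_fun [set: T] f.
Proof.
move=> mf _ A mA; rewrite setTI; move: A mA.
rewrite -[forall A, _]/(g_sigma_preimage coor `<=`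
  [set A | measurable (f @^-1` A)]).
apply: smallest_sub.
  split => /=; first by rewrite preimage_set0.
    by move=> A mA; rewrite setTD preimage_setC; exact: measurableC.
  by move=> F mF; rewrite preimage_bigcup; exact: bigcup_measurable.
move=> A; rewrite -bigcup_seq => -[i _ [B mB <-]] /=.
by rewrite setTI -[X in measurable X]setTI; exact: mf.
Qed.

End measurable_rV.

Section lebesgue_rV.
Context {R : realType}.

Definition consrV n (p : R * 'rV[R]_n) : 'rV[R]_n.+1 :=
  \row_(i < n.+1) oapp (fun j => p.2 0 j) p.1 (unlift ord0 i).

Definition unconsrV n (x : 'rV[R]_n.+1) : R * 'rV[R]_n :=
  (x 0 0, \row_(j < n) x 0 (lift ord0 j)).

Lemma consrVK n : cancel (@consrV n) (@unconsrV n).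
Proof.
case=> a x; rewrite /unconsrV /consrV mxE unlift_none; congr (_, _).
by apply/rowP => j; rewrite !mxE liftK.
Qed.

Lemma measurable_consrV n :
  measurable_fun [set: measurableTypeR R * 'rV[R]_n] (@consrV n).
Proof.
apply: measurable_fun_rV => i.
case: (unliftP ord0 i) => [j|] ->.
- rewrite (_ : _ \o _ = (fun x : 'rV[R]_n => x 0 j : measurableTypeR R) \o snd).
    by apply: measurableT_comp => //; exact: measurable_coor.
  by apply/funext => p /=; rewrite mxE liftK.
- rewrite (_ : _ \o _ = fst) //.
  by apply/funext => p /=; rewrite mxE unlift_none.
Qed.

Lemma measurable_unconsrV n :
  measurable_fun [set: 'rV[R]_n.+1]
    (@unconsrV n : _ -> measurableTypeR R * 'rV[R]_n).
Proof.
apply/measurable_fun_pair; first exact: measurable_coor.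
apply: measurable_fun_rV => j.
rewrite (_ : _ \o _ = fun x : 'rV[R]_n.+1 => x 0 (lift ord0 j) : measurableTypeR R).
  exact: measurable_coor.
by apply/funext => p /=; rewrite mxE.
Qed.

Lemma measurable_preimage_consrV n (A : set 'rV[R]_n.+1) : measurable A ->
  measurable (@consrV n @^-1` A : set (measurableTypeR R * 'rV[R]_n)).
Proof.
by move=> mA; rewrite -[X in measurable X]setTI; exact: measurable_consrV.
Qed.

Section lebesgue_succ.
Context n (mu : {sigma_finite_measure set 'rV[R]_n -> \bar R}).

Definition lebesgue_succ : set 'rV[R]_n.+1 -> \bar R :=
  pushforward (@lebesgue_measure R \x mu)%E (@consrV n).

Let lebesgue_succ0 : lebesgue_succ set0 = 0%E.
Proof. by rewrite /lebesgue_succ /pushforward preimage_set0 measure0. Qed.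

Let lebesgue_succ_ge0 A : (0 <= lebesgue_succ A)%E.
Proof. exact: (@measure_ge0 _ _ _ (@lebesgue_measure R \x mu)%E). Qed.

Let lebesgue_succ_sigma_additive : semi_sigma_additive lebesgue_succ.
Proof.
move=> F mF tF mUF; rewrite /lebesgue_succ /pushforward preimage_bigcup.
apply: measure_semi_sigma_additive.
- by move=> k; exact: measurable_preimage_consrV.
- apply/trivIsetP => /= i j _ _ ij; rewrite -preimage_setI.
  by move/trivIsetP : tF => /(_ _ _ _ _ ij) ->//; rewrite preimage_set0.
- by rewrite -preimage_bigcup; exact: measurable_preimage_consrV.
Qed.

HB.instance Definition _ := isMeasure.Build _ _ _ lebesgue_succ
  lebesgue_succ0 lebesgue_succ_ge0 lebesgue_succ_sigma_additive.

Let lebesgue_succ_sigma_finite : sigma_finite setT lebesgue_succ.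
Proof.
have /sigma_finiteP[F [TF ndF Foo]] := sigma_finiteT (@lebesgue_measure R).
have /sigma_finiteP[G [TG ndG Goo]] := sigma_finiteT mu.
exists (fun k => @unconsrV n @^-1` (F k `*` G k)).
  rewrite -preimage_bigcup -[LHS](preimage_setT (@unconsrV n)); congr preimage.
  rewrite -setXTT TF TG predeqE => -[x y]; split.
    move=> [/= [k _ Fkx] [l _ Gly]]; exists (maxn k l) => //; split.
    - by move: x Fkx; exact/subsetPset/ndF/leq_maxl.
    - by move: y Gly; exact/subsetPset/ndG/leq_maxr.
  by move=> [k _ []/= ? ?]; split; exists k.
move=> k; have [mF Fk] := Foo k; have [mG Gk] := Goo k; split.
  rewrite -[X in measurable X]setTI; apply: measurable_unconsrV => //.
  exact: measurableX.
rewrite /lebesgue_succ /pushforward -comp_preimage.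
rewrite (_ : _ \o _ = id) ?preimage_id; last first.
  by apply/funext => p /=; rewrite consrVK.
by rewrite product_measure1E// lte_mul_pinfty// ge0_fin_numE.
Qed.

HB.instance Definition _ := Measure_isSigmaFinite.Build _ _ _ lebesgue_succ
  lebesgue_succ_sigma_finite.

End lebesgue_succ.

(* Lebesgue measure on R^n, by iterated products; on the one-point space R^0
   it is the Dirac mass. *)
Fixpoint lebesgue_rV n : {sigma_finite_measure set 'rV[R]_n -> \bar R} :=
  if n is n'.+1 then lebesgue_succ (lebesgue_rV n') else \d_(0 : 'rV[R]_0).

Lemma lebesgue_rV_box n (A : 'I_n -> set R) :
  (forall i, measurable (A i : set (measurableTypeR R))) ->
  lebesgue_rV n [set x | forall i, A i (x 0 i)] =
  (\prod_(i < n) lebesgue_measure (A i))%E.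
Proof.
elim: n A => [|n IH] A mA /=.
  by rewrite big_ord0 diracE mem_set//; case.
have mB : measurable [set x : 'rV[R]_n | forall i, A (lift ord0 i) (x 0 i)].
  rewrite (_ : [set _ | _] =
      \bigcap_(i in [set: 'I_n])
        ((fun x : 'rV[R]_n => x 0 i) @^-1` A (lift ord0 i))).
    apply: fin_bigcap_measurable => [|i _]; first exact: finite_finset.
    by rewrite -[X in measurable X]setTI; exact: measurable_coor.
  by apply/seteqP; split => x /= Ax i; [move=> _|]; exact: Ax.
rewrite big_ord_recl -IH// -product_measure1E//.
rewrite /lebesgue_succ /pushforward; congr (_ _).
apply/seteqP; split => -[a x] /= Aax.
  split=> [|i]; first by have := Aax ord0; rewrite mxE unlift_none.
  by have := Aax (lift ord0 i); rewrite mxE liftK.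
by move=> i; rewrite mxE; case: unliftP => [j|] ->; [exact: Aax.2|exact: Aax.1].
Qed.

End lebesgue_rV.

Section calculus.
Context {R : realType} {n : nat}.
Implicit Types (f u v : 'rV[R]_n -> R) (x : 'rV[R]_n) (D Omega : set 'rV[R]_n).

(* The library norm `|x| on row vectors is the sup norm. *)
Definition enorm x : R := Num.sqrt (\sum_(i < n) x 0 i ^+ 2).

Definition partial (i : 'I_n) f : 'rV[R]_n -> R := 'D_(delta_mx 0 i) f.

Definition grad f x : 'rV[R]_n := \row_i partial i f x.

Definition laplacian f x : R := \sum_(i < n) partial i (partial i f) x.

(* For D open: all partial derivatives of order at most k exist and are
   continuous on D. *)
Fixpoint Ck D (k : nat) f : Prop :=
  (forall x, D x -> {for x, continuous f}) /\
  (if k is k'.+1 then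
    forall i : 'I_n, (forall x, D x -> derivable f x (delta_mx 0 i)) /\
      Ck D k' (partial i f)
  else True).

Definition Cinfty D f : Prop := forall k, Ck D k f.

(* phi is only considered on D (its values outside D are irrelevant), and its
   support is a compact subset of Omega. *)
Definition csupport_in D Omega (phi : 'rV[R]_n -> R) : Prop :=
  let supp := closure (D `&` [set x | phi x != 0]) in
  compact supp /\ supp `<=` Omega.

Definition L2 D u : Prop :=
  measurable_fun D u /\ (\int[lebesgue_rV n]_(x in D) (u x ^+ 2)%:E < +oo)%E.

Definition weak_partial D (i : 'I_n) u v : Prop :=
  forall phi, Cinfty D phi -> csupport_in D D phi ->
    \int[lebesgue_rV n]_(x in D) (u x * partial i phi x) =
    - \int[lebesgue_rV n]_(x in D) (v x * phi x).

Definition H1 D u : Prop :=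
  L2 D u /\ forall i, exists v, L2 D v /\ weak_partial D i u v.

Definition unit_ball : set 'rV[R]_n := [set x | enorm x < 1].

Definition punctured_ball : set 'rV[R]_n := unit_ball `\ 0.

Definition radially_decreasing u : Prop :=
  exists U : R -> R,
    (forall x, punctured_ball x -> u x = U (enorm x)) /\
    (forall r s, 0 < r -> r < s -> s < 1 -> U s < U r).

(* Functions on the ball are given by their values off the origin; all the u
   considered here are continuous there. *)
Definition unbounded u : Prop := ~ [bounded u x | x in punctured_ball].

Definition solution (alpha : R) (f : R -> R) u : Prop :=
  Ck punctured_ball 2 u /\
  forall x, punctured_ball x -> - laplacian u x = enorm x `^ alpha * f (u x).

Definition semi_stable (alpha : R) (f : R -> R) u : Prop :=
  forall phi, Ck unit_ball 1 phi -> csupport_in unit_ball punctured_ball phi ->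
    (0 <= \int[lebesgue_rV n]_(x in unit_ball)
      (enorm (grad phi x) ^+ 2 -
       enorm x `^ alpha * derive1 f (u x) * phi x ^+ 2)%:E)%E.

(* u in H^1(B_1) is a semi-stable solution of -Delta u = |x|^alpha f(u) in
   B_1 \ {0}. *)
Definition semi_stable_solution (alpha : R) (f : R -> R) u : Prop :=
  [/\ H1 unit_ball u, solution alpha f u & semi_stable alpha f u].

End calculus.

Definition gammaNa {R : realType} (N : nat) (alpha : R) : R :=
  2 - N%:R / 2 + alpha / 2 +
  Num.sqrt ((alpha + 2) * (alpha + 2 * N%:R - 2)) / 2.

(* Main.v *)
Require Import Defs.
From mathcomp Require Import all_boot all_order all_algebra.
From mathcomp Require Import all_classical all_reals all_analysis.
From mathcomp Require Import measurable_realfun.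
From mathcomp Require Import ring lra.
Import Order.TTheory GRing.Theory Num.Theory.
Import numFieldNormedType.Exports.
Local Open Scope classical_set_scope.
Local Open Scope ring_scope.

(** Off the origin both functions are [u = h (|x|^2)] with
    [h' r = kappa * r^b]: [h r = - ln r / 2] (so [b = -1]) in case (a), and
    [h r = r^(gamma/2) - 1] (so [b = gamma/2 - 1]) in case (b).  Hence
    [D_i u = 2 kappa x_i |x|^(2b)] and the Laplacian is
    [2 kappa (N + 2b) |x|^(2b)], which is the required equation; moreover
    [|x|^alpha f'(u) = K / |x|^2] for a constant [K].  The hypotheses on
    [alpha], [N] and [gamma] force [N >= 3] and [K <= (N-2)^2/4]
    ([hardy_constant_le]); equality holds in case (a).  Semi-stability is then
    Hardy's inequality ([hardy_inequality]).

    One integration by parts ([integral_partialM_eq0]) serves both for the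
    weak derivatives of [u] and for Hardy's inequality: if [a] is C^1 off the
    origin in the direction [e_i], and [a] and [D_i a] are [O(|x|^(-s))] with
    [s < N], then [D_i (a psi)] has integral zero for every C^1 function [psi]
    with compact support in the ball.  No cut-off near the origin is needed:
    by Fubini it suffices that the integral of [D_i (a psi)] along almost every
    line parallel to the i-th axis vanishes, and since [N >= 2] almost every
    such line misses the origin, where the fundamental theorem of calculus
    applies.  Integrability of [|x|^(-s)] follows from a dyadic decomposition
    of the ball ([integrable_le_powR_enorm]).

    For Hardy's inequality take [a_i = x_i / |x|^2], whose divergence is
    [(N-2) / |x|^2], and [psi = phi^2]; with [c = (N-2)/2], expanding
    [0 <= |grad phi + c phi x / |x|^2|^2] gives the claim. *)

(** * Measurability and the Euclidean norm *)

Section measurability.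
Context {R : realType} {n : nat}.

(** An open set is a countable union of open boxes with rational centres and
    radii [1/(k+1)]. *)
Lemma open_measurable_rV (A : set 'rV[R]_n) : open A -> measurable A.
Proof.
move=> oA.
pose box (p : 'rV[rat]_n * nat) : set 'rV[R]_n :=
  [set x | forall i, ratr (p.1 0 i) - p.2.+1%:R^-1 < x 0 i
                     < ratr (p.1 0 i) + p.2.+1%:R^-1].
have mbox p : measurable (box p).
  rewrite (_ : box p = \bigcap_(i in [set: 'I_n])
     ((fun x : 'rV[R]_n => x 0 i) @^-1`
       `](ratr (p.1 0 i) - p.2.+1%:R^-1), (ratr (p.1 0 i) + p.2.+1%:R^-1)[)).
    apply: fin_bigcap_measurable => [|i _]; first exact: finite_finset.
    by rewrite -[X in measurable X]setTI; exact: measurable_coor.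
  apply/seteqP; split => x /= xp i; first by move=> _ /=; rewrite in_itv/= xp.
  by have := xp i I; rewrite /= in_itv.
rewrite (_ : A = \bigcup_p (if `[< box p `<=` A >] then box p else set0)).
  apply: countable_bigcupT_measurable => // p.
  by case: ifPn => // _; exact: measurable0.
apply/seteqP; split=> [x Ax|x [p _]]; last by case: asboolP => // + xp; apply.
have /nbhs_ballP[e /= e0 eA] : nbhs x A by exact: open_nbhs_nbhs.
have e20 : 0 < e / 2 by rewrite divr_gt0.
have [k _ /(_ k (leqnn k)) /= ke] := near_infty_natSinv_lt (PosNum e20).
have k0 : 0 < k.+1%:R^-1 :> R by rewrite invr_gt0.
have /fin_all_exists[c cP] i : exists q : rat,
    x 0 i - k.+1%:R^-1 < ratr q < x 0 i + k.+1%:R^-1.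
  have /rat_in_itvoo[q] : x 0 i - k.+1%:R^-1 < x 0 i + k.+1%:R^-1.
    by rewrite ltrBlDr -addrA ltrDl addr_gt0.
  by rewrite in_itv; exists q.
exists (\row_i c i, k) => //.
case: asboolP => [_ i/=|].
  by rewrite mxE ltrBlDr andbC -[x 0 i < _]ltrBlDr cP.
case=> y yp; apply: eA; split => // i j; rewrite (ord1 i).
have := yp j; rewrite /= mxE => /andP[y1 y2].
have /andP[c1 c2] := cP j.
by move: k.+1%:R^-1 ke y1 y2 c1 c2 => d *; rewrite /ball/= ltr_norml;
  apply/andP; split; lra.
Qed.

Lemma continuous_measurable_rV (f : 'rV[R]_n -> R) :
  continuous f -> measurable_fun [set: 'rV[R]_n] f.
Proof.
move=> /continuousP cf;
  apply: (measurability _ (measurable_realfun.RGenOpens.measurableE R)).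
move=> _ [_ [a [b ->] <-]]; rewrite setTI; apply: open_measurable_rV.
by apply: cf; exact: interval_open.
Qed.

(** The square of the Euclidean norm. *)
Definition sumsq (x : 'rV[R]_n) : R := \sum_(i < n) x 0 i ^+ 2.

Lemma sumsq_ge0 x : 0 <= sumsq x.
Proof. by apply: sumr_ge0 => i _; exact: sqr_ge0. Qed.

Lemma enorm_ge0 (x : 'rV[R]_n) : 0 <= enorm x.
Proof. exact: sqrtr_ge0. Qed.

Lemma sqr_enorm x : enorm x ^+ 2 = sumsq x.
Proof. by rewrite sqr_sqrtr// sumsq_ge0. Qed.

Lemma sqr_coord_le_sumsq (x : 'rV[R]_n) i : x 0 i ^+ 2 <= sumsq x.
Proof.
rewrite /sumsq (bigD1 i)//= lerDl.
by apply: sumr_ge0 => j _; exact: sqr_ge0.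
Qed.

Lemma coord_le_enorm (x : 'rV[R]_n) i : `|x 0 i| <= enorm x.
Proof. by rewrite -sqrtr_sqr ler_wsqrtr// sqr_coord_le_sumsq. Qed.

Lemma sumsq_gt0 x : x != 0 -> 0 < sumsq x.
Proof.
move=> x0; rewrite lt_neqAle sumsq_ge0 andbT eq_sym.
apply: contra_neq x0 => x0; apply/rowP => i; rewrite mxE.
apply/eqP; rewrite -sqrf_eq0 eq_le sqr_ge0 andbT.
by rewrite -x0 sqr_coord_le_sumsq.
Qed.

Lemma enorm_gt0 (x : 'rV[R]_n) : x != 0 -> 0 < enorm x.
Proof. by move=> /sumsq_gt0; rewrite sqrtr_gt0. Qed.

Lemma enorm0 : enorm (0 : 'rV[R]_n) = 0.
Proof.
by rewrite /enorm big1 ?sqrtr0// => i _; rewrite mxE expr0n.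
Qed.

Lemma continuous_sumsq : continuous sumsq.
Proof.
apply: continuous_big; first exact: add_continuous.
by move=> i _ x; apply: (@continuousM _ _ (fun y : 'rV[R]_n => y 0 i)
  (fun y : 'rV[R]_n => y 0 i)); exact: coord_continuous.
Qed.

Lemma continuous_enorm : continuous (@enorm R n).
Proof.
move=> x; apply: (@continuous_comp _ _ _ sumsq Num.sqrt).
  exact: continuous_sumsq.
exact: sqrt_continuous.
Qed.

Lemma measurable_enorm : measurable_fun [set: 'rV[R]_n] (@enorm R n).
Proof. by apply: continuous_measurable_rV; exact: continuous_enorm. Qed.

Lemma open_unit_ball : open (@unit_ball R n).
Proof.
rewrite (_ : unit_ball = @enorm R n @^-1` `]-oo, 1[).
  by move/continuousP : continuous_enorm; apply; exact: interval_open.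
by apply/seteqP; split=> x /=; rewrite in_itv.
Qed.

Lemma measurable_unit_ball : measurable (@unit_ball R n).
Proof. by apply: open_measurable_rV; exact: open_unit_ball. Qed.

Lemma open_neq0 : open [set x : 'rV[R]_n | x != 0].
Proof.
rewrite (_ : [set _ | _] = sumsq @^-1` `]0, +oo[).
  by move/continuousP : continuous_sumsq; apply; exact: interval_open.
apply/seteqP; split=> x /=; rewrite in_itv/= andbT; first exact: sumsq_gt0.
by apply: contraTneq => ->; rewrite -sqr_enorm enorm0 expr0n ltxx.
Qed.

Lemma open_punctured_ball : open (@punctured_ball R n).
Proof.
rewrite (_ : punctured_ball = @unit_ball R n `&` [set x | x != 0]).
  by apply: openI; [exact: open_unit_ball|exact: open_neq0].
by apply/seteqP; split => x [? /eqP].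
Qed.

End measurability.

(** * Integrability of negative powers of the norm *)

Section singular_integrability.
Context {R : realType}.

Lemma lebesgue_rV_ball_le n (r : R) : 0 <= r ->
  (lebesgue_rV n [set x : 'rV[R]_n | enorm x < r]%R <= ((2 * r) ^+ n)%:E)%E.
Proof.
move=> r0; pose A (i : 'I_n) := `](- r), r[%classic.
have mA i : measurable (A i : set (measurableTypeR R)) by exact: measurable_itv.
have -> : ((2 * r) ^+ n)%:E = lebesgue_rV n [set x | forall i, A i (x 0 i)].
  rewrite lebesgue_rV_box//.
  have mAi i : lebesgue_measure (A i) = (2 * r)%:E.
    rewrite /A lebesgue_measure_itv/= lte_fin; case: ltP => h.
      by rewrite -EFinB; congr EFin; ring.
    by congr EFin; lra.
  by under eq_bigr do rewrite mAi; rewrite prodEFin big_const_ord iter_mulr_1.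
apply: le_measure.
- rewrite inE; rewrite -[X in measurable X]setTI.
  rewrite [X in _ `&` X](_ : _ = @enorm R n @^-1` `]-oo, r[).
    exact: measurable_enorm.
  by apply/seteqP; split=> x /=; rewrite in_itv.
- rewrite inE [X in measurable X](_ : _ = \bigcap_(i in [set: 'I_n])
     ((fun x : 'rV[R]_n => x 0 i) @^-1` A i)).
    apply: fin_bigcap_measurable => [|i _]; first exact: finite_finset.
    by rewrite -[X in measurable X]setTI; exact: measurable_coor.
  by apply/seteqP; split => x /= xp i; [move=> _|]; exact: xp.
- move=> x /= xr i; rewrite /A/= in_itv/= -ltr_norml.
  exact: le_lt_trans (coord_le_enorm x i) xr.
Qed.

Lemma nneseries_geometric_lty (a q : R) : 0 <= a -> 0 < q -> q < 1 ->
  (\sum_(k <oo) (a * q ^+ k)%:E < +oo)%E.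
Proof.
move=> a0 q0 q1.
have aq0 k : (0 <= (a * q ^+ k)%:E)%E
  by rewrite lee_fin mulr_ge0// exprn_ge0// ltW.
apply: (@le_lt_trans _ _ (a * (1 - q)^-1)%:E); last exact: ltry.
apply: lime_le; first by apply: is_cvg_nneseries => k _ _; exact: aq0.
apply: nearW => k; rewrite sumEFin lee_fin.
by apply: geometric_le_lim => //; rewrite ger0_norm// ltW.
Qed.

Lemma exprV_powR (x s : R) (m : nat) : 0 <= x ->
  (x^-1 ^+ m) `^ s = ((x `^ s) ^+ m)^-1.
Proof.
move=> x0; rewrite exprVn -powR_inv1 ?exprn_ge0// -powRrM mulN1r powRN.
rewrite -(powR_mulrn m x0) -(powR_mulrn m (powR_ge0 x s)) -[in LHS]powRrM.
by rewrite mulrC powRrM.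
Qed.

Lemma exists_dyadic_shell (r : R) : 0 < r -> r < 1 ->
  exists k : nat, 2^-1 ^+ k.+1 <= r < 2^-1 ^+ k.
Proof.
move=> r0 r1.
have h1 : `|2^-1 : R| < 1 by rewrite ger0_norm//; lra.
have /cvgrPdist_lt/(_ _ r0)[m _ /(_ _ (leqnn m))/=] := cvg_geometric 1 h1.
rewrite sub0r mul1r normrN ger0_norm ?exprn_ge0// => mr.
have ex : exists k : nat, 2^-1 ^+ k <= r by exists m; exact: ltW.
case: (ex_minnP ex) => -[|k] kr kmin.
  by move: kr; rewrite expr0 leNgt r1.
exists k; rewrite kr/= ltNge; apply/negP => /kmin.
by rewrite ltnn.
Qed.

(** On the shell [2^-(k+1) <= |x| < 2^-k] the function is at most
    [|C| 2^(s(k+1))], and the ball of radius [2^-k] has measure at most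
    [(2 * 2^-k)^n]; the resulting geometric series has ratio [2^(s-n) < 1]. *)
Lemma integrable_le_powR_enorm n (f : 'rV[R]_n -> R) (C s : R) :
  measurable_fun [set: 'rV[R]_n] f -> 0 <= s -> s < n%:R ->
  (forall x, unit_ball x -> x != 0 -> `|f x| <= C * enorm x `^ (- s)) ->
  (lebesgue_rV n).-integrable unit_ball (EFin \o f).
Proof.
move=> mf s0 sn fC.
pose A k := [set x : 'rV[R]_n | enorm x < 2^-1 ^+ k].
have mA k : measurable (A k).
  rewrite -[X in measurable X]setTI [X in _ `&` X](_ : _ =
      @enorm R n @^-1` `]-oo, 2^-1 ^+ k[); first exact: measurable_enorm.
  by apply/seteqP; split=> x /=; rewrite in_itv.
(* the constant also bounds [`|f 0|], since the bound in the hypothesis is only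
   available off the origin *)
pose C' := Num.max (`|C| * 2 `^ s) `|f 0|.
have C'0 : 0 <= C' by rewrite le_max normr_ge0 orbT.
pose g k x : \bar R := ((C' * (2 `^ s) ^+ k) * \1_(A k) x)%:E.
have g0 k x : (0 <= g k x)%E.
  by rewrite lee_fin !mulr_ge0// exprn_ge0// powR_ge0.
have mg k (D : set 'rV[R]_n) : measurable_fun D (g k).
  apply: measurable_funTS; apply/measurable_EFinP; apply: measurable_funM => //.
have mB := @measurable_unit_ball R n.
apply/integrableP; split.
  by apply/measurable_EFinP; exact: measurable_funTS.
apply: (@le_lt_trans _ _
  (\int[lebesgue_rV n]_(x in unit_ball) \sum_(k <oo) g k x)%E).
  apply: ge0_le_integral => //=.
  - by apply/measurable_EFinP/measurableT_comp => //; exact: measurable_funTS.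
  - exact: ge0_emeasurable_sum.
  move=> x Bx.
  suff [k gk] : exists k, (`|f x|%:E <= g k x)%E.
    apply: le_trans gk _.
    apply: le_trans (nneseries_lim_ge k.+1 _) => [|j _ _]; last exact: g0.
    by rewrite big_nat_recr//= leeDr// sume_ge0.
  have [->|x0] := eqVneq x 0.
    exists 0%N; rewrite lee_fin expr0 mulr1 indicE mem_set; last first.
      by rewrite /A/= enorm0 expr0.
    by rewrite mulr1 le_max lexx orbT.
  have [k /andP[k1 k2]] := exists_dyadic_shell _ (enorm_gt0 _ x0) Bx.
  exists k; rewrite lee_fin indicE mem_set ?mulr1//.
  apply: le_trans (fC _ Bx x0) _.
  apply: (@le_trans _ _ (`|C| * enorm x `^ (- s))).
    by rewrite ler_wpM2r ?powR_ge0// ler_norm.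
  apply: (@le_trans _ _ (`|C| * (2 `^ s) ^+ k.+1)).
    rewrite ler_wpM2l// powRN -[leRHS]invrK lef_pV2 ?posrE; last 2 first.
    - by rewrite powR_gt0// enorm_gt0.
    - by rewrite invr_gt0 exprn_gt0// powR_gt0.
    rewrite -exprV_powR//.
    by apply: ge0_ler_powR => //; rewrite nnegrE ?exprn_ge0 ?enorm_ge0.
  by rewrite exprS mulrA ler_wpM2r ?exprn_ge0 ?powR_ge0// le_max lexx.
rewrite integral_nneseries//.
pose q : R := 2 `^ s * 2^-1 ^+ n.
apply: (@le_lt_trans _ _ (\sum_(k <oo) ((C' * 2 ^+ n) * q ^+ k)%:E)%E);
  last first.
  apply: nneseries_geometric_lty.
  - by apply: mulr_ge0 => //; exact: exprn_ge0.
  - by apply: mulr_gt0; [exact: powR_gt0|exact: exprn_gt0].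
  - rewrite /q exprVn -powR_mulrn// -powRN -powRD; last first.
      by rewrite pnatr_eq0 implybT.
    by rewrite /powR pnatr_eq0/= expR_lt1 pmulr_llt0 ?subr_lt0// ln_gt0// ltr1n.
apply: lee_nneseries => [k _ _|k _].
  by apply: integral_ge0 => x _.
rewrite /g.
under eq_integral do rewrite EFinM.
rewrite ge0_integralZl//; last first.
- by rewrite lee_fin mulr_ge0// exprn_ge0// powR_ge0.
- by apply/measurable_EFinP; exact: measurable_funTS.
rewrite integral_indic//.
apply: (@le_trans _ _ ((C' * 2 `^ s ^+ k)%:E * ((2 * 2^-1 ^+ k) ^+ n)%:E)%E).
  apply: lee_wpmul2l; first by rewrite lee_fin mulr_ge0// exprn_ge0// powR_ge0.
  apply: le_trans (lebesgue_rV_ball_le n _ _); last by rewrite exprn_ge0.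
  by apply: le_measure; rewrite ?inE;
    [exact: measurableI|exact: mA|move=> x []].
rewrite -EFinM lee_fin /q !exprMn -!exprM (mulnC k n).
by rewrite le_eqVlt; apply/orP; left; apply/eqP; ring.
Qed.

End singular_integrability.

(** * Integration along lines parallel to an axis *)

Section lines.
Context {R : realType}.

(** The point [x] with its [i]-th coordinate replaced by [t]. *)
Definition set_coord n (x : 'rV[R]_n) (i : 'I_n) (t : R) : 'rV[R]_n :=
  \row_j (if j == i then t else x 0 j).

Lemma integral_lebesgue_rVS n (F : 'rV[R]_n.+1 -> R) :
  (lebesgue_rV n.+1).-integrable [set: 'rV[R]_n.+1] (EFin \o F) ->
  (lebesgue_measure \x lebesgue_rV n)%E.-integrable
     [set: measurableTypeR R * 'rV[R]_n] (EFin \o (F \o (@consrV R n))) /\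
  (\int[lebesgue_rV n.+1]_x (F x)%:E =
   \int[lebesgue_measure \x lebesgue_rV n]_p (F (consrV p))%:E)%E.
Proof.
move=> iF; have /measurable_int mF := iF.
have mc := @measurable_consrV R n.
have iFc : (lebesgue_measure \x lebesgue_rV n)%E.-integrable
     [set: measurableTypeR R * 'rV[R]_n] (EFin \o (F \o (@consrV R n))).
  apply/integrableP; split; first exact: (measurableT_comp mF mc).
  move/integrableP : iF => [_] /=.
  rewrite /lebesgue_succ.
  rewrite (@ge0_integral_pushforward _ _ _ _ _ _ mc _ setT
    (abse \o (EFin \o F)))//.
  exact: (measurableT_comp _ mF).
  by move=> y _; exact: abse_ge0.
split => //.
by rewrite /= (@integral_pushforward _ _ _ _ _ _ mc _ _ (EFin \o F)).
Qed.

Lemma set_coord_consrV0 n (y : 'rV[R]_n) a t :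
  set_coord _ (consrV (a, y)) ord0 t = consrV (t, y).
Proof.
apply/rowP => k; rewrite !mxE; case: (unliftP ord0 k) => [j|] -> //=.
Qed.

Lemma set_coord_consrV_lift n (y : 'rV[R]_n) a (j : 'I_n) t :
  set_coord _ (consrV (a, y)) (lift ord0 j) t = consrV (a, set_coord _ y j t).
Proof.
apply/rowP => k; rewrite !mxE; case: (unliftP ord0 k) => [l|] -> /=.
  by rewrite ?mxE (inj_eq lift_inj).
by [].
Qed.

(** Fubini's theorem in the direction of the [i]-th axis, by induction on the
    dimension: the measure is built by adjoining coordinate [0], so either that
    coordinate is integrated first, or the induction hypothesis applies to
    almost every slice. *)
Lemma integral_lines_eq0 n (i : 'I_n) (g : 'rV[R]_n -> R) :
  (lebesgue_rV n).-integrable [set: 'rV[R]_n] (EFin \o g) ->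
  (forall x, \int[lebesgue_measure]_t (g (set_coord n x i t))%:E = 0)%E ->
  (\int[lebesgue_rV n]_x (g x)%:E = 0)%E.
Proof.
elim: n i g => [[]//|n IH] i g ig line0.
have [igc ->] := integral_lebesgue_rVS n g ig.
case: (unliftP ord0 i) => [j|] eqi; subst i.
  rewrite -(integral12_prod_meas1 igc)/=.
  transitivity (\int[@lebesgue_measure R]_x (cst 0%E x))%E; last first.
    by rewrite integral_cst// mul0e.
  apply: ae_eq_integral => //.
    exact: measurable_fubini_F igc.
  apply: filterS (ae_integrable1 igc) => a /= iga _.
  rewrite /fubini_F/=.
  apply: (IH j (fun y => g (consrV (a, y)))) => // y.
  by under eq_integral do rewrite -set_coord_consrV_lift.
rewrite -(integral21_prod_meas1 igc)/=.
apply: integral0_eq => y _.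
rewrite -[RHS](line0 (consrV (0, y))).
by under [RHS]eq_integral do rewrite set_coord_consrV0.
Qed.

Lemma lebesgue_rV_coord_eq0 n (j : 'I_n) :
  lebesgue_rV n [set x : 'rV[R]_n | x 0 j = 0] = 0%E.
Proof.
pose A (i : 'I_n) : set R := if i == j then [set 0] else setT.
have mA i : measurable (A i : set (measurableTypeR R)).
  by rewrite /A; case: ifP => // _; exact: measurable_set1.
have -> : [set x : 'rV[R]_n | x 0 j = 0] = [set x | forall i, A i (x 0 i)].
  apply/seteqP; split=> x /= h; last by have := h j; rewrite /A eqxx.
  by move=> i; rewrite /A; case: eqP => [->|].
rewrite lebesgue_rV_box// (bigD1 j)//=.
rewrite [X in lebesgue_measure X](_ : _ = [set 0]).
  by rewrite lebesgue_measure_set1 mul0e.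
by rewrite /A eqxx.
Qed.

(** The line through the origin may be disregarded: it lies in a hyperplane
    [x_j = 0] with [j != i], which is a null set. *)
Lemma integral_lines_off0_eq0 n (i : 'I_n) (g : 'rV[R]_n -> R) : (1 < n)%N ->
  (lebesgue_rV n).-integrable [set: 'rV[R]_n] (EFin \o g) ->
  (forall x, (forall t, set_coord n x i t != 0)%R ->
    \int[lebesgue_measure]_t (g (set_coord n x i t))%:E = 0)%E ->
  (\int[lebesgue_rV n]_x (g x)%:E = 0)%E.
Proof.
move=> n1 ig line0.
have [j ji] : exists j : 'I_n, j != i.
  case: n n1 i {ig line0 g} => [//|[//|n]] _ i.
  by exists (lift i ord0); rewrite eq_sym neq_lift.
pose Z := [set x : 'rV[R]_n | x 0 j = 0].
have mZ : measurable Z.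
  rewrite -[X in measurable X]setTI.
  exact: (@measurable_coor R n j measurableT [set 0] (measurable_set1 0)).
pose h x := g x * \1_(~` Z) x.
have h0 (x : 'rV[R]_n) : x 0 j = 0 -> h x = 0.
  by move=> xj; rewrite /h indicE memNset ?mulr0//=; exact.
have hg (x : 'rV[R]_n) : x 0 j != 0 -> h x = g x.
  by move=> xj; rewrite /h indicE mem_set ?mulr1//=; exact/eqP.
have mg : measurable_fun [set: 'rV[R]_n] g.
  by apply/measurable_EFinP; exact: measurable_int ig.
have mh : measurable_fun [set: 'rV[R]_n] h.
  apply: measurable_funM => //.
  by apply: measurable_indic; exact: measurableC.
transitivity (\int[lebesgue_rV n]_x (h x)%:E)%E.
  apply: ae_eq_integral => //; [exact/measurable_EFinP..|].
  exists Z; split => //; first exact: lebesgue_rV_coord_eq0.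
  move=> x /= /not_implyP[_] gh; apply: contrapT => /eqP xj.
  by apply: gh; rewrite hg.
apply: (integral_lines_eq0 _ i).
  apply: le_integrable ig => //; first exact/measurable_EFinP.
  move=> x _ /=; rewrite lee_fin.
  by have [/h0->|/hg->//] := eqVneq (x 0 j) 0; rewrite normr0.
move=> x.
have sx t : set_coord n x i t 0 j = x 0 j by rewrite mxE (negbTE ji).
have [xj|xj] := eqVneq (x 0 j) 0.
  by under eq_integral do rewrite h0 ?sx//; rewrite integral0.
under eq_integral do rewrite hg ?sx//.
apply: line0 => t; apply: contraNneq xj => xt.
by rewrite -(sx t) xt mxE.
Qed.

End lines.

(** * Integrals of partial derivatives *)

Section integral_partial.
Context {R : realType}.

(** A directional derivative is the derivative of the restriction to a line. *)
Lemma is_derive_lineP (V : normedModType R) (w : V -> R) (x v : V) (G : R -> R)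
    (t d : R) : (forall h, G (h + t) = w (h *: v + x)) ->
  is_derive x v w d <-> is_derive t (1 : R) G d.
Proof.
move=> Gw.
have Gt : G t = w x by have := Gw 0; rewrite scale0r !add0r.
have E : (fun h : R => h^-1 *: (G (h *: 1 + t) - G t)) =
         (fun h => h^-1 *: (w (h *: v + x) - w x)).
  by apply/funext => h; rewrite [h *: 1]mulr1 Gw Gt.
by split=> -[dw dE]; apply: DeriveDef; move: dw dE;
  rewrite /derivable /derive /= E.
Qed.

Lemma integral_derive_support (G G' : R -> R) :
  (forall t : R, is_derive t (1 : R) G (G' t)) -> continuous G' ->
  (forall t, 1 <= `|t| -> G t = 0 /\ G' t = 0) ->
  (\int[lebesgue_measure]_t (G' t)%:E = 0)%E.
Proof.
move=> dG cG' supp.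
have cG : continuous G.
  move=> t; apply: differentiable_continuous; apply/derivable1_diffP.
  by have [] := dG t.
rewrite (_ : (fun t => (G' t)%:E) = ((EFin \o G') \_ `[-1, 1])); last first.
  apply/funext => t; rewrite patchE; case: ifPn => //.
  rewrite notin_setE/= in_itv/= -ler_norml => /negP; rewrite -ltNge => /ltW.
  by move=> /supp[_ ->].
rewrite -integral_mkcond (@continuous_FTC2 _ G' G).
- have [-> _] : G 1 = 0 /\ G' 1 = 0 by apply: supp; rewrite normr1.
  have [-> _] : G (-1) = 0 /\ G' (-1) = 0 by apply: supp; rewrite normrN1.
  by rewrite subee.
- by rewrite gtrN.
- exact: continuous_subspaceT.
- split=> [t _||]; first by have [] := dG t.
  + by apply: cvg_at_right_filter; exact: cG.
  + by apply: cvg_at_left_filter; exact: cG.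
- by move=> t _; rewrite derive1E; have [_ ->] := dG t.
Qed.

Lemma set_coordE n (x : 'rV[R]_n) i (h t : R) :
  set_coord n x i (h + t) = h *: delta_mx 0 i + set_coord n x i t.
Proof.
apply/rowP => j; rewrite !mxE eqxx/=; case: (j == i); first by rewrite mulr1.
by rewrite mulr0 add0r.
Qed.

Lemma continuous_set_coord n (x : 'rV[R]_n) i : continuous (set_coord n x i).
Proof.
have -> : set_coord n x i = (fun t => t *: delta_mx 0 i + set_coord n x i 0).
  by apply/funext => t; rewrite -set_coordE addr0.
move=> t; apply: cvgD; last exact: cvg_cst.
by apply: cvgZr_tmp; exact: cvg_id.
Qed.

(** On a line that misses the origin, [dw] is the continuous derivative of the
    restriction of [w], which vanishes off [[-1, 1]]. *)
Lemma integral_partial_eq0 n (i : 'I_n) (w dw : 'rV[R]_n -> R) : (1 < n)%N ->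
  (lebesgue_rV n).-integrable [set: 'rV[R]_n] (EFin \o dw) ->
  (forall x, x != 0 -> is_derive x (delta_mx 0 i) w (dw x)) ->
  (forall x, x != 0 -> {for x, continuous dw}) ->
  (forall x, ~ unit_ball x -> w x = 0 /\ dw x = 0) ->
  (\int[lebesgue_rV n]_x (dw x)%:E = 0)%E.
Proof.
move=> n1 idw dwP cdw supp; apply: (integral_lines_off0_eq0 _ i) => // x x0.
apply: (integral_derive_support (fun t => w (set_coord n x i t))
  (fun t => dw (set_coord n x i t))).
- move=> t.
  have [h|+ _] := is_derive_lineP _ w (set_coord n x i t) (delta_mx 0 i)
    (fun t => w (set_coord n x i t)) t (dw (set_coord n x i t)).
    by rewrite set_coordE.
  by apply; apply: dwP; exact: x0.
- move=> t; apply: (@continuous_comp _ _ _ (set_coord n x i) dw).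
    exact: continuous_set_coord.
  exact: cdw.
- move=> t t1; apply: supp => /=; apply/negP; rewrite -leNgt.
  apply: le_trans t1 _; have := coord_le_enorm (set_coord n x i t) i.
  by rewrite mxE eqxx.
Qed.

End integral_partial.

(** * Test functions extended by zero *)

Lemma near_eq_continuous_for (T U : topologicalType) (f g : T -> U) (x : T) :
  {near x, f =1 g} -> {for x, continuous f} -> {for x, continuous g}.
Proof.
move=> fg cf; rewrite /prop_for /continuous_at -(nbhs_singleton fg).
by apply: cvg_trans cf; exact: near_eq_cvg.
Qed.

Section test_functions.
Context {R : realType} {n : nat}.
Implicit Types (f psi : 'rV[R]_n -> R).

(** Bounded continuous functions on the whole space that vanish off the unit
    ball. *)
Definition bounded_continuous_in_ball f :=
  [/\ continuous f, exists M : R, forall x, `|f x| <= M &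
     forall x, ~ unit_ball x -> f x = 0].

(** C^1 functions on the whole space that, together with their first partial
    derivatives, are bounded and vanish off the unit ball. *)
Definition test_fun psi := bounded_continuous_in_ball psi /\
  forall i : 'I_n, (forall x, derivable psi x (delta_mx 0 i)) /\
    bounded_continuous_in_ball (partial i psi).

Lemma bounded_continuous_in_ballP f (K : set 'rV[R]_n) : continuous f ->
  compact K -> K `<=` unit_ball -> (forall x, ~ K x -> f x = 0) ->
  bounded_continuous_in_ball f.
Proof.
move=> cf cK KB f0; split => //; last by move=> x xB; apply: f0 => /KB.
have [M [_ fM]] :=
  compact_bounded (continuous_compact (continuous_subspaceT cf) cK).
have M1 : M < `|M| + 1 by rewrite (le_lt_trans (ler_norm _))// ltrDl.
exists (`|M| + 1) => x.
have [Kx|/f0->] := pselect (K x); first by apply: (fM _ M1); exists x.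
by rewrite normr0 addr_ge0.
Qed.

(** Near a point of the ball the extension by zero coincides with [phi], and
    near a point off the support it is zero; every point is of one of these
    two kinds. *)
Lemma test_fun_extension (phi : 'rV[R]_n -> R) :
  Ck unit_ball 1 phi -> csupport_in unit_ball unit_ball phi ->
  test_fun (phi \_ unit_ball) /\
  forall i x, unit_ball x -> partial i (phi \_ unit_ball) x = partial i phi x.
Proof.
move=> [cphi dphi] [cK KB].
set K := closure _ in cK KB; set psi := phi \_ unit_ball.
have oB := @open_unit_ball R n.
have near_in (x : 'rV[R]_n) : unit_ball x -> \forall y \near x, unit_ball y.
  by move=> Bx; apply: open_nbhs_nbhs; split.
have psi_in (x : 'rV[R]_n) : unit_ball x -> {near x, phi =1 psi}.
  move=> /near_in; apply: filterS => y By.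
  by rewrite /psi patchE mem_set.
have near_out (x : 'rV[R]_n) : ~ K x -> \forall y \near x, ~ K y.
  move=> Kx; apply: open_nbhs_nbhs; split => //.
  by apply: closed_openC; exact: closed_closure.
have psi_out (x : 'rV[R]_n) : ~ K x -> {near x, cst 0 =1 psi}.
  move=> /near_out; apply: filterS => y Ky.
  rewrite /psi patchE; case: ifPn => // /set_mem By.
  have [->//|phiy] := eqVneq (phi y) 0.
  by exfalso; apply: Ky; apply: subset_closure.
have BK (x : 'rV[R]_n) : unit_ball x \/ ~ K x.
  by have [/KB|] := pselect (K x); [left|right].
have dpsi_in (i : 'I_n) (x : 'rV[R]_n) : unit_ball x ->
    partial i psi x = partial i phi x.
  by move=> Bx; apply/esym/near_eq_derive; exact: psi_in.
have dpsi_out (i : 'I_n) (x : 'rV[R]_n) : ~ K x -> partial i psi x = 0.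
  move=> Kx; rewrite /partial -(near_eq_derive _ (psi_out _ Kx)).
  exact: derive_cst.
split => //; split.
  apply: (bounded_continuous_in_ballP _ _ _ cK KB).
    move=> x; have [Bx|Kx] := BK x.
      by apply: near_eq_continuous_for _ _ _ _ _ (psi_in _ Bx) _; exact: cphi.
    by apply: near_eq_continuous_for _ _ _ _ _ (psi_out _ Kx) _;
      exact: cst_continuous.
  by move=> x Kx; rewrite -(nbhs_singleton (psi_out _ Kx)).
move=> i; have [dphii [cdphi _]] := dphi i; split.
  move=> x; have [Bx|Kx] := BK x.
    by apply: near_eq_derivable (psi_in _ Bx) _; exact: dphii.
  by apply: near_eq_derivable (psi_out _ Kx) _; exact: derivable_cst.
apply: (bounded_continuous_in_ballP _ _ _ cK KB); last exact: dpsi_out.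
move=> x; have [Bx|Kx] := BK x.
  apply: near_eq_continuous_for _ _ _ _ _ _ (cdphi _ Bx).
  by move: (near_in _ Bx); apply: filterS => y By; rewrite dpsi_in.
apply: (near_eq_continuous_for _ _ (cst 0)); last exact: cst_continuous.
by move: (near_out _ Kx); apply: filterS => y Ky; rewrite dpsi_out.
Qed.

Lemma bounded_continuous_in_ballM f g : bounded_continuous_in_ball f ->
  bounded_continuous_in_ball g -> bounded_continuous_in_ball (f \* g).
Proof.
move=> [cf [M fM] f0] [cg [L gL] g0]; split.
- by move=> x; apply: continuousM; [exact: cf|exact: cg].
- by exists (M * L) => x; rewrite normrM ler_pM.
- by move=> x xB /=; rewrite f0// mul0r.
Qed.

Lemma test_fun_sqr psi : test_fun psi -> test_fun (psi \* psi) /\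
  forall i x, partial i (psi \* psi) x = 2 * psi x * partial i psi x.
Proof.
move=> [bpsi dpsi].
have d2 i x : is_derive x (delta_mx 0 i) (psi \* psi)
    (2 * psi x * partial i psi x).
  have [dp _] := dpsi i.
  apply: is_derive_eq.
    by apply: is_deriveM; apply: derivableP; exact: dp.
  by rewrite /partial [2 * _]mulr_natl mulr2n mulrDl.
have pE j : partial j (psi \* psi) =
    (fun x => psi x * partial j psi x + psi x * partial j psi x).
  by apply/funext => x; have [_ dE] := d2 j x;
    rewrite [LHS]dE mulr_natl mulr2n mulrDl.
split; last by move=> i x; rewrite pE mulr_natl mulr2n mulrDl.
split; first exact: bounded_continuous_in_ballM.
move=> i; split; first by move=> x; have [] := d2 i x.
have [_ /(bounded_continuous_in_ballM _ _ bpsi)[cp [M pM] p0]] := dpsi i.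
rewrite pE; split.
- by move=> x; apply: (@continuousD _ _ _ (psi \* partial i psi)
    (psi \* partial i psi)); exact: cp.
- exists (M + M) => x; rewrite (le_trans (ler_normD _ _))//.
  by apply: lerD; exact: pM.
- by move=> x xB; have /= -> := p0 _ xB; rewrite addr0.
Qed.

End test_functions.

(** * Integration by parts with a singularity at the origin *)

Section singular_integration_by_parts.
Context {R : realType} {n : nat}.
Implicit Types (a f g psi : 'rV[R]_n -> R) (s : R).

(** Measurable functions that are continuous off the origin and [O(|x|^(-s))] in
    the unit ball; the value at the origin is arbitrary. *)
Definition singular_fun s f :=
  [/\ measurable_fun [set: 'rV[R]_n] f,
      forall x, x != 0 -> {for x, continuous f} &
      exists C : R, forall x, unit_ball x -> x != 0 ->
        `|f x| <= C * enorm x `^ (- s)].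

Lemma integrable_singular_fun s f : 0 <= s -> s < n%:R -> singular_fun s f ->
  (lebesgue_rV n).-integrable unit_ball (EFin \o f).
Proof.
by move=> s0 sn [mf _ [C fC]]; exact: integrable_le_powR_enorm fC.
Qed.

Lemma singular_funM s f g : singular_fun s f -> bounded_continuous_in_ball g ->
  singular_fun s (f \* g).
Proof.
move=> [mf cf [C fC]] [cg [M gM] _]; split.
- by apply: measurable_funM => //; exact: continuous_measurable_rV.
- by move=> x x0; apply: continuousM; [exact: cf|exact: cg].
- exists (C * M) => x Bx x0.
  by rewrite normrM mulrAC ler_pM// fC.
Qed.

Lemma singular_funD s f g : singular_fun s f -> singular_fun s g ->
  singular_fun s (f \+ g).
Proof.
move=> [mf cf [C fC]] [mg cg [D gD]]; split.
- exact: measurable_funD.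
- by move=> x x0; apply: continuousD; [exact: cf|exact: cg].
- exists (C + D) => x Bx x0.
  by rewrite (le_trans (ler_normD _ _))// mulrDl lerD ?fC ?gD.
Qed.

(** The integrand is [D_i (a psi)] off the origin, hence its integral along
    every line parallel to the [i]-th axis that misses the origin is zero. *)
Lemma integral_partialM_eq0 (i : 'I_n) s a a' psi : (1 < n)%N ->
  0 <= s -> s < n%:R -> singular_fun s a -> singular_fun s a' ->
  (forall x, x != 0 -> is_derive x (delta_mx 0 i) a (a' x)) ->
  test_fun psi ->
  let g x := a x * partial i psi x + a' x * psi x in
  (lebesgue_rV n).-integrable unit_ball (EFin \o g) /\
  (\int[lebesgue_rV n]_(x in unit_ball) (g x)%:E = 0)%E.
Proof.
move=> n1 s0 sn Sa Sa' da [bpsi dpsi] g.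
have [ddpsi bdpsi] := dpsi i.
have mB := @measurable_unit_ball R n.
have gB : g = g \_ unit_ball.
  apply/funext => x; rewrite patchE; case: ifPn => //.
  rewrite notin_setE => xB; rewrite /g.
  by have [_ _ ->//] := bdpsi; have [_ _ ->//] := bpsi; rewrite !mulr0 addr0.
have Sg : singular_fun s g.
  by apply: singular_funD; exact: singular_funM.
have Ig := integrable_singular_fun _ _ s0 sn Sg.
split => //.
rewrite integral_mkcond -[X in patch _ _ X]/(EFin \o g) restrict_EFin -gB.
apply: (@integral_partial_eq0 _ _ i (a \* psi) g n1).
- by rewrite gB -restrict_EFin; exact: (integrable_mkcond _ mB).1 Ig.
- move=> x x0; rewrite /g; have dax := da _ x0.
  have dpx := derivableP (ddpsi x).
  apply: is_derive_eq.
  by rewrite /partial; congr (_ + _); rewrite mulrC.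
- by have [_ + _] := Sg.
- move=> x xB; have [_ _ p0] := bpsi; have [_ _ dp0] := bdpsi.
  by rewrite /g /= p0// dp0// !mulr0 addr0.
Qed.

Lemma integration_by_parts_singular (i : 'I_n) s a a' psi : (1 < n)%N ->
  0 <= s -> s < n%:R -> singular_fun s a -> singular_fun s a' ->
  (forall x, x != 0 -> is_derive x (delta_mx 0 i) a (a' x)) ->
  test_fun psi ->
  \int[lebesgue_rV n]_(x in unit_ball) (a x * partial i psi x) =
  - \int[lebesgue_rV n]_(x in unit_ball) (a' x * psi x).
Proof.
move=> n1 s0 sn Sa Sa' da tpsi; have [bpsi dpsi] := tpsi.
have [_ g0] := integral_partialM_eq0 _ _ _ _ _ n1 s0 sn Sa Sa' da tpsi.
have I1 :=
  integrable_singular_fun _ _ s0 sn (singular_funM _ _ _ Sa (dpsi i).2).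
have I2 := integrable_singular_fun _ _ s0 sn (singular_funM _ _ _ Sa' bpsi).
apply/eqP; rewrite -subr_eq0 opprK -RintegralD//;
  last exact: measurable_unit_ball.
by rewrite /Rintegral g0.
Qed.

End singular_integration_by_parts.

(** * Calculus of powers of the norm *)

Section radial_calculus.
Context {R : realType} {n : nat}.
Implicit Types (x : 'rV[R]_n) (b : R).

Lemma sumsq_line x (i : 'I_n) (t : R) :
  sumsq (t *: delta_mx 0 i + x) = sumsq x + (2 * x 0 i * t + t ^+ 2).
Proof.
rewrite /sumsq (bigD1 i)//= [in RHS](bigD1 i)//= !mxE !eqxx/= mulr1.
rewrite (eq_bigr (fun j => x 0 j ^+ 2)); first by ring.
by move=> j ji; rewrite !mxE (negbTE ji) mulr0 add0r.
Qed.

Lemma is_derive_coord x (i j : 'I_n) :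
  is_derive x (delta_mx 0 j) (fun y : 'rV[R]_n => y 0 i) (i == j)%:R.
Proof.
have [h|_] := is_derive_lineP _ (fun y : 'rV[R]_n => y 0 i) x (delta_mx 0 j)
  (fun t => (i == j)%:R * t + x 0 i) 0 (i == j)%:R.
  by rewrite !mxE !eqxx/= addr0 mulrC.
apply; apply: is_derive_eq.
by rewrite /GRing.scale/= mulr1 addr0.
Qed.

Lemma is_derive_radial (h : R -> R) x (i : 'I_n) (d : R) :
  is_derive (sumsq x) (1 : R) h d ->
  is_derive x (delta_mx 0 i) (h \o sumsq) (2 * x 0 i * d).
Proof.
move=> dh.
pose G (t : R) := sumsq x + (2 * x 0 i * t + t ^+ 2).
have [t|_] := is_derive_lineP _ (h \o sumsq) x (delta_mx 0 i) (h \o G) 0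
  (2 * x 0 i * d).
  by rewrite /= sumsq_line addr0.
apply; rewrite mulrC; apply: is_derive1_comp.
  by rewrite /G mulr0 expr0n !addr0.
rewrite /G; apply: is_derive_eq.
by rewrite /GRing.scale/=; ring.
Qed.

Lemma is_derive_sumsq_powR b x (i : 'I_n) : x != 0 ->
  is_derive x (delta_mx 0 i) (fun y : 'rV[R]_n => sumsq y `^ b)
    (2 * x 0 i * (b * sumsq x `^ (b - 1))).
Proof.
move=> x0; apply: (@is_derive_radial (fun r => r `^ b)).
by apply: is_derive1_powR; exact: sumsq_gt0.
Qed.

(** The field [x |-> |x|^(2b) x], coordinate by coordinate. *)
Definition coord_powR b (i : 'I_n) x : R := x 0 i * sumsq x `^ b.

(** The [j]-th partial derivative of [coord_powR b i] off the origin. *)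
Definition dcoord_powR b (i j : 'I_n) x : R :=
  (i == j)%:R * sumsq x `^ b + 2 * b * (x 0 i * x 0 j) * sumsq x `^ (b - 1).

Lemma is_derive_coord_powR b x (i j : 'I_n) : x != 0 ->
  is_derive x (delta_mx 0 j) (coord_powR b i) (dcoord_powR b i j x).
Proof.
move=> x0; have d1 := is_derive_coord x i j.
have d2 := is_derive_sumsq_powR b x j x0.
apply: is_derive_eq.
by rewrite /dcoord_powR /GRing.scale/=; ring.
Qed.

Lemma sumsq_powR b x : sumsq x `^ b = enorm x `^ (2 * b).
Proof. by rewrite -sqr_enorm -powR_mulrn ?enorm_ge0// -powRrM. Qed.

(** The divergence of the field [|x|^(2b) x]. *)
Lemma sum_dcoord_powR b x : x != 0 ->
  \sum_(i < n) dcoord_powR b i i x = (n%:R + 2 * b) * sumsq x `^ b.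
Proof.
move=> x0.
have E : sumsq x * sumsq x `^ (b - 1) = sumsq x `^ b.
  rewrite -[X in X * _]powRr1 ?sumsq_ge0// -powRD; first by rewrite addrC subrK.
  by apply/implyP => _; rewrite gt_eqF// sumsq_gt0.
rewrite (eq_bigr (fun i => sumsq x `^ b +
    2 * b * (x 0 i) ^+ 2 * sumsq x `^ (b - 1))) => [|i _]; last first.
  by rewrite /dcoord_powR eqxx mul1r expr2.
rewrite big_split/= sumr_const card_ord -mulr_suml -mulr_sumr -/(sumsq x).
by rewrite -(mulrA (2 * b)) E [RHS]mulrDl [n%:R * _]mulr_natl.
Qed.

Lemma continuous_for_sumsq_powR b x : x != 0 ->
  {for x, continuous (fun y : 'rV[R]_n => sumsq y `^ b)}.
Proof.
move=> /sumsq_gt0 x0.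
apply: (@continuous_comp _ _ _ sumsq (fun r => r `^ b)).
  exact: continuous_sumsq.
apply/differentiable_continuous/derivable1_diffP.
by have [] := is_derive1_powR b x0.
Qed.

Lemma continuous_for_coord_powR b i x : x != 0 ->
  {for x, continuous (coord_powR b i)}.
Proof.
move=> x0; apply: (@continuousM _ _ (fun y : 'rV[R]_n => y 0 i)
  (fun y : 'rV[R]_n => sumsq y `^ b)); first exact: coord_continuous.
exact: continuous_for_sumsq_powR.
Qed.

Lemma continuous_for_dcoord_powR b i j x : x != 0 ->
  {for x, continuous (dcoord_powR b i j)}.
Proof.
move=> x0.
apply: (@continuousD _ _ _ (fun y : 'rV[R]_n => (i == j)%:R * sumsq y `^ b)
    (fun y => 2 * b * (y 0 i * y 0 j) * sumsq y `^ (b - 1))).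
  apply: (@continuousM _ _ (cst (i == j)%:R) (fun y => sumsq y `^ b)).
    exact: cst_continuous.
  exact: continuous_for_sumsq_powR.
apply: (@continuousM _ _ (fun y : 'rV[R]_n => 2 * b * (y 0 i * y 0 j))
    (fun y => sumsq y `^ (b - 1))); last exact: continuous_for_sumsq_powR.
apply: (@continuousM _ _ (cst (2 * b)) (fun y : 'rV[R]_n => y 0 i * y 0 j)).
  exact: cst_continuous.
by apply: (@continuousM _ _ (fun y : 'rV[R]_n => y 0 i)
  (fun y : 'rV[R]_n => y 0 j)); exact: coord_continuous.
Qed.

Lemma measurable_sumsq_powR b :
  measurable_fun [set: 'rV[R]_n] (fun x : 'rV[R]_n => sumsq x `^ b).
Proof.
apply: (measurableT_comp (measurable_powR b)).
by apply: continuous_measurable_rV; exact: continuous_sumsq.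
Qed.

Lemma measurable_coord_powR b i :
  measurable_fun [set: 'rV[R]_n] (coord_powR b i).
Proof.
apply: measurable_funM; last exact: measurable_sumsq_powR.
exact: measurable_coor.
Qed.

Lemma measurable_dcoord_powR b i j :
  measurable_fun [set: 'rV[R]_n] (dcoord_powR b i j).
Proof.
apply: measurable_funD.
  by apply: measurable_funM => //; exact: measurable_sumsq_powR.
apply: measurable_funM; last exact: measurable_sumsq_powR.
apply: measurable_funM => //.
by apply: measurable_funM; exact: measurable_coor.
Qed.

Lemma enorm_powR_le (p q : R) x : unit_ball x -> x != 0 -> q <= p ->
  enorm x `^ p <= enorm x `^ q.
Proof.
move=> Bx x0 qp; apply: ger_powR => //.
by rewrite enorm_gt0//= ltW.
Qed.

Lemma coord_powR_le b i x : x != 0 ->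
  `|coord_powR b i x| <= enorm x `^ (2 * b + 1).
Proof.
move=> x0; rewrite normrM (ger0_norm (powR_ge0 _ _)) sumsq_powR.
rewrite powRD; last by apply/implyP => _; rewrite gt_eqF// enorm_gt0.
rewrite powRr1 ?enorm_ge0// mulrC ler_wpM2l ?powR_ge0//.
exact: coord_le_enorm.
Qed.

Lemma dcoord_powR_le b i j x : x != 0 ->
  `|dcoord_powR b i j x| <= (1 + 2 * `|b|) * enorm x `^ (2 * b).
Proof.
move=> x0; rewrite -sumsq_powR mulrDl; have b0 := powR_ge0 (sumsq x) b.
apply: le_trans (ler_normD _ _) _; apply: lerD.
  by rewrite normrM (ger0_norm b0) ler_wpM2r//; case: (i == j);
    rewrite ?normr1 ?normr0.
rewrite -[_ * _ * _ * _]mulrA normrM (normrM 2) (@ger0_norm _ 2)//.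
rewrite ler_wpM2l ?mulr_ge0// normrM (ger0_norm (powR_ge0 _ _)).
rewrite -[in leRHS](subrK 1 b) [leRHS]powRD; last first.
  by apply/implyP => _; rewrite gt_eqF// sumsq_gt0.
rewrite powRr1 ?sumsq_ge0// mulrC ler_wpM2l ?powR_ge0//.
by rewrite normrM -sqr_enorm expr2 ler_pM// coord_le_enorm.
Qed.

Lemma singular_sumsq_powR b s : - s <= 2 * b ->
  singular_fun s (fun x => sumsq x `^ b).
Proof.
move=> sb; split; first exact: measurable_sumsq_powR.
  by move=> x; exact: continuous_for_sumsq_powR.
exists 1 => x Bx x0; rewrite mul1r ger0_norm ?powR_ge0// sumsq_powR.
exact: enorm_powR_le.
Qed.

Lemma singular_coord_powR b i s : - s <= 2 * b + 1 ->
  singular_fun s (coord_powR b i).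
Proof.
move=> sb; split; first exact: measurable_coord_powR.
  by move=> x; exact: continuous_for_coord_powR.
exists 1 => x Bx x0; rewrite mul1r; apply: le_trans (coord_powR_le b i x x0) _.
exact: enorm_powR_le.
Qed.

Lemma singular_dcoord_powR b i j s : - s <= 2 * b ->
  singular_fun s (dcoord_powR b i j).
Proof.
move=> sb; split; first exact: measurable_dcoord_powR.
  by move=> x; exact: continuous_for_dcoord_powR.
exists (1 + 2 * `|b|) => x Bx x0; apply: le_trans (dcoord_powR_le b i j x x0) _.
by rewrite ler_wpM2l ?addr_ge0 ?mulr_ge0//; exact: enorm_powR_le.
Qed.

End radial_calculus.

(** * Hardy's inequality and membership in H^1 *)

Section hardy_and_sobolev.
Context {R : realType} {n : nat}.
Implicit Types (f u psi : 'rV[R]_n -> R) (s : R).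

Lemma singular_fun_bounded s f : 0 <= s -> bounded_continuous_in_ball f ->
  singular_fun s f.
Proof.
move=> s0 [cf [M fM] _]; split; first exact: continuous_measurable_rV.
  by move=> x _; exact: cf.
exists M => x Bx x0; have M0 : 0 <= M by exact: le_trans (fM x).
apply: le_trans (fM x) _; rewrite ler_peMr//.
rewrite -(powRr0 (enorm x)); apply: enorm_powR_le => //.
by rewrite oppr_le0.
Qed.

Lemma sqr_enorm_grad f x :
  enorm (grad f x) ^+ 2 = \sum_(i < n) partial i f x ^+ 2.
Proof. by rewrite sqr_enorm; apply: eq_bigr => i _; rewrite mxE. Qed.

(** The difference of the two sides is, with [c = (n-2)/2],
    [|grad psi + c psi x / |x|^2|^2 + ((n-2)^2/4 - K) psi^2 / |x|^2]. *)
Lemma hardy_pointwise psi (K : R) x : x != 0 -> K <= (n%:R - 2) ^+ 2 / 4 ->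
  - ((n%:R - 2) / 2) * \sum_(i < n)
     (coord_powR (-1) i x * (2 * psi x * partial i psi x) +
      dcoord_powR (-1) i i x * (psi x * psi x)) <=
  \sum_(i < n) partial i psi x ^+ 2 - K * sumsq x `^ (-1) * psi x ^+ 2.
Proof.
move=> x0 Kn; set c := (n%:R - 2) / 2.
have r0 := sumsq_gt0 _ x0.
rewrite big_split/= -mulr_suml sum_dcoord_powR//.
have S0 : 0 <=
    \sum_(i < n) (partial i psi x + c * coord_powR (-1) i x * psi x) ^+ 2.
  by apply: sumr_ge0 => i _; exact: sqr_ge0.
have SE :
   \sum_(i < n) (partial i psi x + c * coord_powR (-1) i x * psi x) ^+ 2 =
   \sum_(i < n) partial i psi x ^+ 2 +
   c * (\sum_(i < n) coord_powR (-1) i x * (2 * psi x * partial i psi x)) +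
   c ^+ 2 * psi x ^+ 2 * sumsq x `^ (-1).
  have -> : sumsq x `^ (-1) = \sum_(i < n) coord_powR (-1) i x ^+ 2.
    rewrite /coord_powR powR_inv1 ?(ltW r0)//.
    under eq_bigr do rewrite exprMn.
    by rewrite -mulr_suml -/(sumsq x) expr2 mulrA divff ?mul1r// gt_eqF.
  by rewrite !mulr_sumr -!big_split/=; apply: eq_bigr => i _; ring.
have P0 : 0 <= sumsq x `^ (-1) by exact: powR_ge0.
have Q0 := mulr_ge0 P0 (sqr_ge0 (psi x)).
have KQ : K * (sumsq x `^ (-1) * psi x ^+ 2) <=
    (n%:R - 2) ^+ 2 / 4 * (sumsq x `^ (-1) * psi x ^+ 2) by rewrite ler_wpM2r.
rewrite SE in S0; move: S0 KQ; rewrite /c.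
move: (\sum_(i < n) _ ^+ 2) (\sum_(i < n) _ * _) (sumsq x `^ (-1)) => A B D.
nra.
Qed.

(** Hardy's inequality, for any potential that is equal to [K / |x|^2] off the
    origin with [K <= (n-2)^2/4]. *)
Lemma hardy_inequality (phi V : 'rV[R]_n -> R) (K : R) : (2 < n)%N ->
  K <= (n%:R - 2) ^+ 2 / 4 ->
  (forall x, punctured_ball x -> V x = K * sumsq x `^ (-1)) ->
  Ck unit_ball 1 phi -> csupport_in unit_ball punctured_ball phi ->
  (0 <= \int[lebesgue_rV n]_(x in unit_ball)
    (enorm (grad phi x) ^+ 2 - V x * phi x ^+ 2)%:E)%E.
Proof.
move=> n2 Kn VK C1 [cK KB].
have phi0 : phi 0 = 0.
  apply: contrapT => /eqP p0.
  have [|_] := KB 0; last exact.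
  by apply: subset_closure; split; rewrite /unit_ball/= ?enorm0.
have csB : csupport_in unit_ball unit_ball phi.
  by split => //; apply: subset_trans KB _ => x [].
have [tpsi dpsi] := test_fun_extension _ C1 csB.
move: tpsi dpsi; set psi := phi \_ unit_ball => tpsi dpsi.
have psiE x : unit_ball x -> psi x = phi x.
  by move=> Bx; rewrite /psi patchE mem_set.
have [bpsi bdpsi] := tpsi.
have [tpsi2 dpsi2] := test_fun_sqr _ tpsi.
have mB := @measurable_unit_ball R n.
have n2R : 2 < n%:R :> R by rewrite ltr_nat.
pose I x :=
  \sum_(i < n) partial i psi x ^+ 2 - K * sumsq x `^ (-1) * psi x ^+ 2.
(* [D_i (x_i psi^2 / |x|^2)], which is [O(|x|^(-2))] and has integral zero *)
pose Z i x := coord_powR (-1) i x * partial i (psi \* psi) x +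
  dcoord_powR (-1) i i x * (psi \* psi) x.
have ZP i : (lebesgue_rV n).-integrable unit_ball (EFin \o (Z i)) /\
  (\int[lebesgue_rV n]_(x in unit_ball) (Z i x)%:E = 0)%E.
  apply: (@integral_partialM_eq0 _ _ i 2) => //.
  - by rewrite (ltn_trans _ n2).
  - by apply: singular_coord_powR; lra.
  - by apply: singular_dcoord_powR; lra.
  - by move=> x; exact: is_derive_coord_powR.
pose Zs x : \bar R := (\sum_(i < n) (Z i x)%:E)%E.
have iZs : (lebesgue_rV n).-integrable unit_ball Zs.
  by apply: integrable_sum => // i _; exact: (ZP i).1.
have Zs0 : (\int[lebesgue_rV n]_(x in unit_ball) Zs x = 0)%E.
  rewrite integral_sum// => [|i]; last exact: (ZP i).1.
  by rewrite big1// => i _; exact: (ZP i).2.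
pose c : R := (n%:R - 2) / 2.
have iI : (lebesgue_rV n).-integrable unit_ball (EFin \o I).
  have i1 : (lebesgue_rV n).-integrable unit_ball
      (fun x => \sum_(i < n) (partial i psi x ^+ 2)%:E)%E.
    apply: integrable_sum => // i _.
    apply: (integrable_singular_fun 0); rewrite ?ltr0n ?(ltn_trans _ n2)//.
    apply: singular_fun_bounded => //.
    by apply: bounded_continuous_in_ballM; exact: (bdpsi i).2.
  have i2 : (lebesgue_rV n).-integrable unit_ball
      (EFin \o ((fun x => sumsq x `^ (-1)) \* (psi \* psi))).
    apply: (integrable_singular_fun 2) => //.
    apply: singular_funM; last exact: bounded_continuous_in_ballM.
    by apply: singular_sumsq_powR; lra.
  apply: eq_integrable (integrableB mB i1 (integrableZl mB K i2)) => // x _.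
  by rewrite /= sumEFin /I -mulrA EFinB EFinM.
rewrite [leRHS](_ : _ =
  \int[lebesgue_rV n]_(x in unit_ball) (I x)%:E)%E; last first.
  apply: eq_integral => x /set_mem Bx; congr EFin.
  rewrite /I sqr_enorm_grad psiE//; congr (_ - _).
    by apply: eq_bigr => i _; rewrite dpsi.
  have [->|/eqP x0] := eqVneq x 0; first by rewrite phi0 expr0n !mulr0.
  by rewrite VK.
(* compare with the integrand of integral zero in the pointwise inequality *)
rewrite -[leLHS](mule0 (- c)%:E) -Zs0 -integralZl//.
apply: le_integral => //; first exact: integrableZl.
move=> x /set_mem Bx; rewrite /Zs sumEFin -EFinM lee_fin.
have [x0|x0] := eqVneq x 0.
  rewrite big1 => [|i _].
    rewrite mulr0 /I x0 psiE// ?phi0; last by rewrite -x0.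
    rewrite expr0n mulr0 subr0.
    by apply: sumr_ge0 => i _; exact: sqr_ge0.
  rewrite /Z dpsi2/= psiE// x0 phi0.
  by rewrite !(mulr0, mul0r) addr0.
have := hardy_pointwise psi K x x0 Kn.
apply: le_trans; rewrite le_eqVlt; apply/orP; left; apply/eqP.
by congr (_ * _); apply: eq_bigr => i _; rewrite /Z dpsi2.
Qed.

Lemma L2_singular s f : 0 <= s -> 2 * s < n%:R -> singular_fun s f ->
  L2 unit_ball f.
Proof.
move=> s0 sn [mf cf [C fC]]; split; first exact: measurable_funTS.
have : (lebesgue_rV n).-integrable unit_ball (EFin \o (fun x => f x ^+ 2)).
  apply: (@integrable_le_powR_enorm _ _ _ (C ^+ 2) (2 * s)) => //.
  - exact: measurable_funX.
  - by rewrite mulr_ge0.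
  move=> x Bx x0; rewrite normrX.
  have -> : enorm x `^ (- (2 * s)) = (enorm x `^ (- s)) ^+ 2.
    by rewrite -powR_mulrn ?powR_ge0// -powRrM; congr (_ `^ _); ring.
  by rewrite -exprMn lerXn2r ?nnegrE// ?fC// (le_trans _ (fC x Bx x0)).
move=> /integrableP[_]; congr (_ < _)%E; apply: eq_integral => x _ /=.
by rewrite ger0_norm// sqr_ge0.
Qed.

(** The partial derivatives [da] of [a] off the origin are the weak partial
    derivatives of [u] in the whole ball. *)
Lemma H1_singular s (u a : 'rV[R]_n -> R) (da : 'I_n -> 'rV[R]_n -> R) :
  (1 < n)%N -> 0 <= s -> 2 * s < n%:R ->
  (forall x, unit_ball x -> a x = u x) ->
  singular_fun s a -> (forall i, singular_fun s (da i)) ->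
  (forall i x, x != 0 -> is_derive x (delta_mx 0 i) a (da i x)) ->
  H1 unit_ball u.
Proof.
move=> n1 s0 sn au Sa Sda daP.
have sn' : s < n%:R by lra.
have [ma a2] := L2_singular _ _ s0 sn Sa.
split; first split.
- by apply: eq_measurable_fun ma => x /set_mem; exact: au.
- apply: le_lt_trans a2; rewrite le_eqVlt; apply/orP; left; apply/eqP.
  by apply: eq_integral => x /set_mem Bx; rewrite au.
move=> i; exists (da i); split; first exact: L2_singular (Sda i).
move=> phi Cphi csphi.
have [tpsi dpsi] := test_fun_extension _ (Cphi 1%N) csphi.
have ibp :=
  integration_by_parts_singular _ _ _ _ _ n1 s0 sn' Sa (Sda i) (daP i) tpsi.
transitivity (\int[lebesgue_rV n]_(x in unit_ball)
    (a x * partial i (phi \_ unit_ball) x)).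
  by apply: eq_Rintegral => x /set_mem Bx; rewrite au// dpsi.
rewrite ibp; congr (- _); apply: eq_Rintegral => x Bx.
by rewrite patchE Bx.
Qed.

End hardy_and_sobolev.

(** * Radial functions and their Laplacian *)

Section radial_solutions.
Context {R : realType} {n : nat}.
Implicit Types (f g u : 'rV[R]_n -> R) (D : set 'rV[R]_n).

Lemma open_near D x : open D -> D x -> \forall y \near x, D y.
Proof. by move=> oD Dx; apply: open_nbhs_nbhs; split. Qed.

Lemma partial_eq_on D f g (i : 'I_n) : open D -> {in D, f =1 g} ->
  {in D, partial i f =1 partial i g}.
Proof.
move=> oD fg x /set_mem Dx; apply: near_eq_derive.
by move: (open_near _ _ oD Dx); apply: filterS => y Dy; apply: fg;
  exact/mem_set.
Qed.

Lemma Ck_eq_on D k f g : open D -> {in D, f =1 g} -> Ck D k f -> Ck D k g.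
Proof.
move=> oD; elim: k f g => [|k IH] f g fg [cf df].
all: have nfg x : D x -> {near x, f =1 g}
  by move=> Dx; move: (open_near _ _ oD Dx); apply: filterS => y Dy;
    apply: fg; exact/mem_set.
all: split; first by
  move=> x Dx; apply: near_eq_continuous_for (nfg _ Dx) _; exact: cf.
  by [].
move=> i; have [dfi Cfi] := df i; split.
  by move=> x Dx; apply: near_eq_derivable (nfg _ Dx) _; exact: dfi.
by apply: IH Cfi; exact: partial_eq_on.
Qed.

Lemma radial_Ck2_laplacian (h : R -> R) (kappa b : R) u :
  (forall r : R, 0 < r -> is_derive r (1 : R) h (kappa * r `^ b)) ->
  (forall x, punctured_ball x -> u x = h (sumsq x)) ->
  Ck punctured_ball 2 u /\
  forall x, punctured_ball x ->
    laplacian u x = 2 * kappa * (n%:R + 2 * b) * sumsq x `^ b.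
Proof.
move=> hP uh; have oD := @open_punctured_ball R n.
have D0 (x : 'rV[R]_n) : punctured_ball x -> x != 0 by move=> [_ /eqP].
pose d1 (i : 'I_n) (x : 'rV[R]_n) := 2 * kappa * coord_powR b i x.
have dh (i : 'I_n) (x : 'rV[R]_n) : x != 0 ->
    is_derive x (delta_mx 0 i) (h \o sumsq) (d1 i x).
  move=> x0; apply: is_derive_eq.
    by apply: is_derive_radial; apply: hP; exact: sumsq_gt0.
  by rewrite /d1 /coord_powR; ring.
have dd1 (i j : 'I_n) (x : 'rV[R]_n) : x != 0 ->
    is_derive x (delta_mx 0 j) (d1 i) (2 * kappa * dcoord_powR b i j x).
  move=> x0; have := is_derive_coord_powR b x i j x0 => dc.
  by have := @is_deriveZ _ _ _ _ (2 * kappa) _ _ _ dc.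
have ud : {in punctured_ball, u =1 h \o sumsq} by move=> x /set_mem; exact: uh.
have pu (i : 'I_n) : {in punctured_ball, d1 i =1 partial i u}.
  move=> x Dx; rewrite (partial_eq_on _ _ _ _ oD ud)//.
  by have [_ ] := dh i x (D0 _ (set_mem Dx)).
have ppu (i j : 'I_n) : {in punctured_ball,
    (fun x => 2 * kappa * dcoord_powR b i j x) =1 partial j (partial i u)}.
  move=> x Dx; rewrite -(partial_eq_on _ _ _ _ oD (pu i))//.
  by have [_ ] := dd1 i j x (D0 _ (set_mem Dx)).
split; last first.
  move=> x Dx; rewrite -mulrA -sum_dcoord_powR; last exact: D0.
  by rewrite mulr_sumr; apply: eq_bigr => i _; rewrite -ppu//; exact/mem_set.
apply: (Ck_eq_on _ _ (h \o sumsq)) => //; first by move=> x /ud.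
have cM (f : 'rV[R]_n -> R) x : {for x, continuous f} ->
    {for x, continuous (fun y => 2 * kappa * f y)}.
  by move=> cf; apply: (@continuousM _ _ (cst (2 * kappa)) f) => //;
    exact: cst_continuous.
split.
  move=> x /D0/sumsq_gt0 r0; apply: (@continuous_comp _ _ _ sumsq h).
    exact: continuous_sumsq.
  by apply/differentiable_continuous/derivable1_diffP; have [] := hP _ r0.
move=> i; split; first by move=> x /D0 x0; have [] := dh i x x0.
apply: (Ck_eq_on _ _ (d1 i)) => //.
  by move=> x Dx; rewrite pu// (partial_eq_on _ _ _ _ oD ud).
split; first by move=> x /D0 x0; apply: cM; exact: continuous_for_coord_powR.
move=> j; split; first by move=> x /D0 x0; have [] := dd1 i j x x0.
apply: (Ck_eq_on _ _ (fun x => 2 * kappa * dcoord_powR b i j x)) => //.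
  by move=> x Dx; rewrite ppu// -(partial_eq_on _ _ _ _ oD (pu i)).
split => //.
by move=> x /D0 x0; apply: cM; exact: continuous_for_dcoord_powR.
Qed.

End radial_solutions.

(** * The two families of solutions *)

Section main.
Context {R : realType} {n : nat}.
Implicit Types (u : 'rV[R]_n -> R).

Lemma unbounded_radial u (U : R -> R) : (0 < n)%N ->
  (forall x, punctured_ball x -> u x = U (enorm x)) ->
  (forall M, exists t : R, [/\ 0 < t, t < 1 & M < `|U t|]) ->
  unbounded u.
Proof.
move=> n0 uU Ubig [M [_ /(_ (`|M| + 1))]].
have -> : M < `|M| + 1 by rewrite (le_lt_trans (ler_norm _))// ltrDl.
move=> /(_ isT) /= bu.
have [t [t0 t1 Mt]] := Ubig (`|M| + 1).
pose x : 'rV[R]_n := t *: delta_mx 0 (Ordinal n0).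
have ex : enorm x = t.
  rewrite /enorm (bigD1 (Ordinal n0))//= big1 => [|j j0].
    by rewrite addr0 !mxE !eqxx mulr1 sqrtr_sqr gtr0_norm.
  by rewrite !mxE (negbTE j0) mulr0 expr0n.
have Dx : punctured_ball x.
  split; first by rewrite /unit_ball/= ex.
  by move=> /= x0; move: t0; rewrite -ex x0 enorm0 ltxx.
by have := bu x Dx; rewrite uU// ex leNgt Mt.
Qed.

(** Both families at once: [u = h (|x|^2)] with [h' r = kappa * r^b]; the last
    two conditions on [f] are the equation and the inverse-square form of the
    potential, written in the variable [r = |x|]. *)
Lemma radial_semi_stable_solution (alpha kappa b s C K : R) (h f : R -> R) u :
  (2 < n)%N -> 0 <= s -> 2 * s < n%:R -> - s <= 2 * b + 1 ->
  K <= (n%:R - 2) ^+ 2 / 4 ->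
  measurable_fun [set: R] h ->
  (forall r : R, 0 < r -> is_derive r (1 : R) h (kappa * r `^ b)) ->
  (forall r : R, 0 < r -> r < 1 -> `|h (r ^+ 2)| <= C * r `^ (- s)) ->
  (forall x, unit_ball x -> u x = h (sumsq x)) ->
  (forall r : R, 0 < r -> r < 1 ->
    - (2 * kappa * (n%:R + 2 * b) * r `^ (2 * b)) =
      r `^ alpha * f (h (r ^+ 2))) ->
  (forall r : R, 0 < r -> r < 1 ->
    r `^ alpha * derive1 f (h (r ^+ 2)) = K * r `^ (-2)) ->
  H1 unit_ball u /\ semi_stable_solution alpha f u.
Proof.
move=> n2 s0 sn sb Kn mh hP hC uh lapE stabE.
have n1 : (1 < n)%N by rewrite (ltn_trans _ n2).
have D1 (x : 'rV[R]_n) : punctured_ball x -> 0 < enorm x /\ enorm x < 1.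
  by move=> [Bx /eqP x0]; rewrite enorm_gt0.
have hE x : punctured_ball x -> u x = h (sumsq x) by move=> [+ _]; exact: uh.
have dh (i : 'I_n) (x : 'rV[R]_n) : x != 0 ->
    is_derive x (delta_mx 0 i) (h \o sumsq) (coord_powR b i x * (2 * kappa)).
  move=> x0; apply: is_derive_eq.
    by apply: is_derive_radial; apply: hP; exact: sumsq_gt0.
  by rewrite /coord_powR; ring.
have Hu : H1 unit_ball u.
  apply: (H1_singular s u (h \o sumsq)
    (fun i x => coord_powR b i x * (2 * kappa))) => //.
  - by move=> x /uh.
  - split.
    + apply: measurableT_comp => //.
      by apply: continuous_measurable_rV; exact: continuous_sumsq.
    + move=> x x0; apply: (@continuous_comp _ _ _ sumsq h).
        exact: continuous_sumsq.
      apply/differentiable_continuous/derivable1_diffP.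
      by have [] := hP _ (sumsq_gt0 _ x0).
    + exists C => x Bx x0; rewrite /= -sqr_enorm; apply: hC => //.
      exact: enorm_gt0.
  - move=> i; have [mc cc [E cE]] := singular_coord_powR b i s sb.
    split; first exact: measurable_funM.
      move=> x x0; apply: (@continuousM _ _ (coord_powR b i) (cst (2 * kappa))).
        exact: cc.
      exact: cst_continuous.
    exists (E * `|2 * kappa|) => x Bx x0.
    by rewrite normrM mulrAC ler_wpM2r// cE.
have [C2 lap] := radial_Ck2_laplacian h kappa b u hP hE.
split => //; split => //.
- split => // x Dx; have [r0 r1] := D1 x Dx.
  by rewrite lap// hE// -sqr_enorm -lapE// sqr_enorm sumsq_powR.
- move=> phi Cphi csphi.
  apply: (hardy_inequality phi _ K) => // x Dx; have [r0 r1] := D1 x Dx.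
  by rewrite hE// -sqr_enorm stabE// sqr_enorm sumsq_powR mulrN1.
Qed.

End main.

(** The difference of the two sides is a quadratic polynomial in [gamma] whose
    larger root is [gammaNa N alpha]. *)
Lemma hardy_constant_le {R : realType} (N : nat) (alpha gamma : R) :
  (2 <= N)%N -> - 2 < alpha -> gammaNa N alpha <= gamma ->
  (gamma + N%:R - 2) * (2 + alpha - gamma) <= (N%:R - 2) ^+ 2 / 4.
Proof.
move=> N2 a2; rewrite /gammaNa.
have N2R : 2 <= N%:R :> R by rewrite ler_nat.
have D0 : 0 <= (alpha + 2) * (alpha + 2 * N%:R - 2) by apply: mulr_ge0; lra.
have := sqr_sqrtr D0; have := sqrtr_ge0 ((alpha + 2) * (alpha + 2 * N%:R - 2)).
move: (Num.sqrt _) => S S0 SE gS.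
have : S ^+ 2 <= (2 * gamma - 4 + N%:R - alpha) ^+ 2.
  by rewrite lerXn2r ?nnegrE//; lra.
by rewrite SE; nra.
Qed.

(** Hence [|x|^(gamma-1)] is square integrable near the origin for
    [gammaNa N alpha <= gamma]. *)
Lemma gammaNa_gt {R : realType} (N : nat) (alpha : R) : - 2 < alpha ->
  1 - N%:R / 2 < gammaNa N alpha.
Proof.
move=> a2; rewrite /gammaNa.
have := sqrtr_ge0 ((alpha + 2) * (alpha + 2 * N%:R - 2)).
by lra.
Qed.

Lemma powR_expR {R : realType} (r a : R) : 0 < r -> r `^ a = expR (a * ln r).
Proof. by move=> r0; rewrite /powR gt_eqF. Qed.

Lemma ltr_powR_neg {R : realType} (g r t : R) : g < 0 -> 0 < r -> r < t ->
  t `^ g < r `^ g.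
Proof.
move=> g0 r0 rt; have t0 : 0 < t by exact: lt_trans rt.
by rewrite !powR_expR// ltr_expR ltr_nM2l// ltr_ln.
Qed.

Lemma derive1_scale_expR {R : realType} (k c t : R) :
  derive1 (fun t : R => k * expR (c * t)) t = k * c * expR (c * t).
Proof.
have dg : is_derive t (1 : R) (fun t => c * t) c.
  by apply: is_derive_eq; rewrite /GRing.scale/= mulr1.
have de := is_derive1_comp (is_derive_expR (c * t)) dg.
rewrite derive1E; have [_ ->] := @is_deriveZ _ _ _ _ k _ _ _ de.
by rewrite /GRing.scale/=; ring.
Qed.

Lemma derive1_scale_powR {R : realType} (k p t : R) : 0 < 1 + t ->
  derive1 (fun t : R => k * (1 + t) `^ p) t = k * p * (1 + t) `^ (p - 1).
Proof.
move=> t0; have dg : is_derive t (1 : R) (fun t => 1 + t) 1.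
  have := @is_deriveD _ _ _ _ _ _ _ _ _
    (is_derive_cst (1 : R) t 1) (is_derive_id t (1 : R)).
  by rewrite add0r.
have de := is_derive1_comp (is_derive1_powR p t0) dg.
rewrite derive1E; have [_ ->] := @is_deriveZ _ _ _ _ k _ _ _ de.
by rewrite /GRing.scale/=; ring.
Qed.

Theorem mainTheorem2 (R : realType) (N : nat) (alpha : R)
    (hN : (2 <= N)%N) (halpha : - 2 < alpha) :
  (N%:R = 10 + 4 * alpha ->
    let f := fun t : R => (N%:R - 2) * expR ((2 + alpha) * t) in
    let u := fun x : 'rV[R]_N => `|ln (enorm x)| in
    [/\ radially_decreasing u, unbounded u, H1 unit_ball u
      & semi_stable_solution alpha f u]) /\
  (10 + 4 * alpha < N%:R ->
    forall gamma : R, gammaNa N alpha <= gamma -> gamma < 0 ->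
    let f := fun t : R =>
      - gamma * (gamma + N%:R - 2) * (1 + t) `^ (1 + (2 + alpha) / - gamma) in
    let u := fun x : 'rV[R]_N => enorm x `^ gamma - 1 in
    [/\ radially_decreasing u, unbounded u, H1 unit_ball u
      & semi_stable_solution alpha f u]).
Proof.
split => [NE f u|Nlt gamma gN g0 f u].
  have n2 : (2 < N)%N by rewrite -(ltr_nat R) NE; lra.
  have n2R : 2 < N%:R :> R by rewrite ltr_nat.
  have ln_sqr (r : R) : 0 < r -> - (ln (r ^+ 2) / 2) = - ln r.
    by move=> r0; rewrite lnXn// mulr2n; lra.
  have rd : radially_decreasing u.
    exists (fun r => `|ln r|); split => // r t r0 rt t1.
    have t0 : 0 < t by exact: lt_trans rt.
    rewrite !ltr0_norm ?ln_lt0 ?t0 ?r0 ?(lt_trans rt)//.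
    by rewrite ltrN2 ltr_ln ?posrE.
  have ub : unbounded u.
    apply: (unbounded_radial u (fun r => `|ln r|)) => //; first exact: ltnW.
    move=> M; exists (expR (- (`|M| + 1))); split; first exact: expR_gt0.
      by rewrite expR_lt1 oppr_lt0 ltr_wpDl.
    rewrite normr_id expRK normrN (le_lt_trans (ler_norm M))//.
    by rewrite (lt_le_trans _ (ler_norm _))// ltrDl.
  have [] : H1 unit_ball u /\ semi_stable_solution alpha f u; last by [].
  (* both [u] and its gradient are [O(1 / |x|)] *)
  apply: (radial_semi_stable_solution alpha (- 2^-1) (-1) 1 1
     ((N%:R - 2) * (2 + alpha)) (fun r => - (ln r / 2))) => //.
  - by rewrite mulr1.
  - by lra.
  - by rewrite NE; nra.
  - by apply: measurableT_comp => //; apply: measurable_funM.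
  - move=> r r0; have dl := is_derive1_ln r0.
    apply: is_derive_eq.
    by rewrite powR_inv1 ?ltW// /GRing.scale/=; lra.
  - move=> r r0 r1; rewrite ln_sqr// powR_inv1 ?(ltW r0)// mul1r.
    rewrite -lnV ?posrE// ger0_norm ?ln_ge0// ?invf_ge1 ?(ltW r1)//.
    by apply/ltW/ln_sublinear; rewrite invr_gt0.
  - move=> x Bx; have [->|x0] := eqVneq x 0.
      by rewrite /u -sqr_enorm enorm0 expr0n !ln0// normr0 mul0r oppr0.
    rewrite -sqr_enorm ln_sqr ?enorm_gt0// /u ler0_norm//.
    by rewrite ln_le0// ltW.
  - move=> r r0 r1; rewrite ln_sqr// /f !powR_expR// [RHS]mulrCA -expRD -mulNr.
    by congr (_ * expR _); lra.
  - move=> r r0 r1; rewrite ln_sqr// !powR_expR//.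
    by rewrite /f derive1_scale_expR mulrCA -expRD; congr (_ * expR _); lra.
have n2 : (2 < N)%N by rewrite -(ltr_nat R); lra.
have n2R : 2 < N%:R :> R by rewrite ltr_nat.
have sqr_powR (r : R) : 0 < r -> (r ^+ 2) `^ (gamma / 2) = r `^ gamma.
  by move=> r0; rewrite -powR_mulrn ?ltW// -powRrM mulrC divfK.
have shift (r : R) : 1 + (r `^ gamma - 1) = r `^ gamma by rewrite addrC subrK.
have gn0 : gamma != 0 by rewrite lt_eqF.
have gN' := gammaNa_gt N alpha halpha.
have rd : radially_decreasing u.
  exists (fun r => r `^ gamma - 1); split => // r t r0 rt t1.
  by rewrite ltrD2r ltr_powR_neg.
have ub : unbounded u.
  apply: (unbounded_radial u (fun r => r `^ gamma - 1)) => //;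
    first exact: ltnW.
  move=> M; pose B : R := `|M| + 2.
  have B1 : 1 < B by rewrite /B; have := normr_ge0 M; lra.
  have B0 : 0 < B by exact: lt_trans B1.
  exists (B `^ gamma^-1); split; first exact: powR_gt0.
    rewrite powR_expR// expR_lt1 pmulr_llt0 ?invr_lt0//.
    exact: ln_gt0.
  rewrite -powRrM mulVf ?lt_eqF// powRr1 ?(ltW B0)//.
  rewrite (lt_le_trans _ (ler_norm _))// /B.
  by have := ler_norm M; lra.
have [] : H1 unit_ball u /\ semi_stable_solution alpha f u; last by [].
(* both [u] and its gradient are [O(|x|^(gamma-1))] *)
apply: (radial_semi_stable_solution alpha (gamma / 2) (gamma / 2 - 1)
  (1 - gamma) 1 ((gamma + N%:R - 2) * (2 + alpha - gamma))
  (fun r => r `^ (gamma / 2) - 1)) => //.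
- by lra.
- by lra.
- by lra.
- exact: hardy_constant_le.
- by apply: measurable_funB => //; exact: measurable_powR.
- move=> r r0; have dp := is_derive1_powR (gamma / 2) r0.
  by apply: is_derive_eq; rewrite subr0.
- move=> r r0 r1; rewrite mul1r sqr_powR//.
  rewrite ger0_norm; last first.
    by rewrite subr_ge0 -(powRr0 r); apply: ger_powR; rewrite ?r0 ltW.
  apply: (@le_trans _ _ (r `^ gamma)); first by rewrite gerBl.
  by apply: ger_powR; [rewrite r0 ltW|lra].
- move=> x Bx; rewrite /u sumsq_powR; congr (_ `^ _ - 1); by field.
- move=> r r0 r1; rewrite sqr_powR//.
  rewrite /f shift -powRrM !powR_expR// [RHS]mulrCA -expRD -mulNr.
  by congr (_ * expR _); field.
- move=> r r0 r1; rewrite sqr_powR//.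
  have rg0 := powR_gt0 gamma r0.
  rewrite /f derive1_scale_powR; last by rewrite shift.
  rewrite shift -powRrM !powR_expR// mulrCA -expRD.
  by congr (_ * expR _); field.
Qed.
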